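(* Consider the quadrotor Euler--Lagrange system $$\mathbf{M}(\mathbf{q})\ddot{\mathbf{q}}+\mathbf{C}(\mathbf{q},\dot{\mathbf{q}})\dot{\mathbf{q}}+\mathbf{G}(\mathbf{q})=\mathbf{F},$$ with generalized coordinates $\mathbf{q}=(x,y,z,\phi,\theta,\psi)^T\in\mathbb{R}^6$, input $\mathbf{F}(t)\in\mathbb{R}^6$ and output $\mathbf{q}$. Here $\mathbf{M}(\mathbf{q})$ is the symmetric positive definite inertia matrix, $\mathbf{C}(\mathbf{q},\dot{\mathbf{q}})$ is the Coriolis and centrifugal matrix (defined from $\mathbf{M}$ by the Christoffel symbols), and $\mathbf{G}(\mathbf{q})=\frac{\partial U(\mathbf{q})}{\partial\mathbf{q}}$ is the gravitational vector, where $U(\mathbf{q})$ is the potential energy, assumed to have an absolute minimum at $\mathbf{q}=\mathbf{0}$. Then the system with input $\mathbf{F}$ and output $\mathbf{q}$ is nonlinear negative imaginary, with a positive definite storage function given by $$V(\mathbf{q},\dot{\mathbf{q}})=\tfrac12\,\dot{\mathbf{q}}^T\mathbf{M}(\mathbf{q})\dot{\mathbf{q}}+U(\mathbf{q}).$$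
   Context: Nonlinear negative imaginary (NI): a system $\dot{\mathbf{x}}=\mathbf{f}(\mathbf{x},\mathbf{u})$, $\mathbf{y}=\mathbf{h}(\mathbf{x})$, with $\mathbf{f}:\mathbb{R}^n\times\mathbb{R}^m\to\mathbb{R}^n$ Lipschitz continuous and $\mathbf{h}:\mathbb{R}^n\to\mathbb{R}^m$ continuously differentiable, is called nonlinear negative imaginary if there exists a non-negative function $V:\mathbb{R}^n\to\mathbb{R}$ of class $C^1$ (called the storage function) such that $\dot V(\mathbf{x}(t))\le\dot{\mathbf{y}}(t)^T\mathbf{u}(t)$ for all $t\ge0$. Here the state is $(\mathbf{q},\dot{\mathbf{q}})$, the input is $\mathbf{u}=\mathbf{F}$ (generalized forces) and the output is $\mathbf{y}=\mathbf{q}$. The generalized coordinates consist of the position $(x,y,z)$ of the center of mass and the roll, pitch and yaw angles $(\phi,\theta,\psi)$. The Coriolis and centrifugal matrix is not uniquely determined by the equations of motion. The Christoffel-symbol choice is $$C_{kj}(\mathbf{q},\dot{\mathbf{q}})=\frac12\sum_{i=1}^{6}\left(\frac{\partial M_{kj}}{\partial q_i}+\frac{\partial M_{ki}}{\partial q_j}-\frac{\partial M_{ij}}{\partial q_k}\right)\dot q_i .$$ With this choice, $\dot{\mathbf{M}}(\mathbf{q})-2\mathbf{C}(\mathbf{q},\dot{\mathbf{q}})$ is skew-symmetric.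
   Formalization: The absolute minimum of U at 0 is taken to be strict with U(0)=0 (otherwise V is not positive definite), ''Lipschitz continuous'' is read as locally Lipschitz (Coriolis terms are quadratic in velocity), and M, U are assumed C^1 with locally Lipschitz derivatives. *)

(* Defs.v *)
From HB Require Import structures.
From mathcomp Require Import all_boot all_order all_algebra.
From mathcomp Require Import all_classical all_reals all_analysis.

Set Implicit Arguments.
Unset Strict Implicit.
Unset Printing Implicit Defensive.

Import Order.TTheory GRing.Theory Num.Theory.
Import numFieldNormedType.Exports.

Local Open Scope classical_set_scope.
Local Open Scope ring_scope.

Definition locally_lipschitz (R : realType) (V W : normedModType R)
    (f : V -> W) : Prop :=
  forall a : V, exists2 A, nbhs a A & [lipschitz f x | x in A].

(* For finite-dimensional V, continuity of every directional derivative is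
   continuity of the differential. *)
Definition class_C1 (R : realType) (V W : normedModType R)
    (f : V -> W) : Prop :=
  (forall a, differentiable f a) /\ (forall v, continuous ('D_v f)).

Definition class_C11 (R : realType) (V W : normedModType R)
    (f : V -> W) : Prop :=
  class_C1 f /\ (forall v, locally_lipschitz ('D_v f)).

(* Derivative at t of a curve on the half-line [0, +oo[: two-sided for t > 0,
   from the right at t = 0. *)
Definition has_time_derivative (R : realType) (W : normedModType R)
    (x : R -> W) (t : R) (l : W) : Prop :=
  (fun h : R => h^-1 *: (x (t + h) - x t))
    @ within [set h | 0 <= t + h] (0 : R)^' --> l.

(* The horizon T may be +oo; finite T covers solutions escaping in finite
   time. *)
Definition is_solution (R : realType) (n m : nat)
    (f : 'cV[R]_n * 'cV[R]_m -> 'cV[R]_n) (T : \bar R)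
    (u : R -> 'cV[R]_m) (x : R -> 'cV[R]_n) : Prop :=
  forall t : R, 0 <= t -> (t%:E < T)%E ->
    has_time_derivative x t (f (x t, u t)).

Definition is_storage_function (R : realType) (n m : nat)
    (f : 'cV[R]_n * 'cV[R]_m -> 'cV[R]_n) (h : 'cV[R]_n -> 'cV[R]_m)
    (V : 'cV[R]_n -> R) : Prop :=
  [/\ forall x, 0 <= V x,
      class_C1 V &
      forall (T : \bar R) (u : R -> 'cV[R]_m) (x : R -> 'cV[R]_n),
        is_solution f T u x ->
        forall t : R, 0 <= t -> (t%:E < T)%E ->
          exists (dV : R) (dy : 'cV[R]_m),
            [/\ has_time_derivative (V \o x) t dV,
                has_time_derivative (h \o x) t dy &
                dV <= (dy^T *m u t) 0 0]].

(* "Lipschitz continuous" is read locally, the sense in which it gives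
   well-posedness: Coriolis terms are quadratic in the velocity, so mechanical
   systems are in general not globally Lipschitz. *)
Definition nonlinear_negative_imaginary (R : realType) (n m : nat)
    (f : 'cV[R]_n * 'cV[R]_m -> 'cV[R]_n)
    (h : 'cV[R]_n -> 'cV[R]_m) : Prop :=
  [/\ locally_lipschitz f,
      class_C1 h &
      exists V : 'cV[R]_n -> R, is_storage_function f h V].

Definition sym_posdef (R : realType) (n : nat) (A : 'M[R]_n) : Prop :=
  A^T = A /\ (forall v : 'cV[R]_n, v != 0 -> 0 < (v^T *m A *m v) 0 0).

Definition posdef_function (R : realType) (n : nat) (V : 'cV[R]_n -> R)
    : Prop :=
  V 0 = 0 /\ (forall x, x != 0 -> 0 < V x).

Definition strict_absolute_minimum_at (R : realType) (n : nat)
    (U : 'cV[R]_n -> R) (a : 'cV[R]_n) : Prop :=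
  forall q, q != a -> U a < U q.

Definition partial (R : realType) (n : nat) (i : 'I_n)
    (g : 'cV[R]_n -> R) (q : 'cV[R]_n) : R :=
  'D_(delta_mx i 0) g q.

Definition gradient (R : realType) (n : nat) (U : 'cV[R]_n -> R)
    (q : 'cV[R]_n) : 'cV[R]_n :=
  \col_k partial k U q.

Definition coriolis (R : realType) (n : nat) (M : 'cV[R]_n -> 'M[R]_n)
    (q v : 'cV[R]_n) : 'M[R]_n :=
  \matrix_(k, j) (2^-1 * \sum_(i < n)
    (partial i (fun p => M p k j) q + partial j (fun p => M p k i) q
     - partial k (fun p => M p i j) q) * v i 0).

(* State space form of M(q) q'' + C(q, q') q' + G(q) = F, with state
   (q, q') stacked in a column. *)
Definition euler_lagrange (R : realType) (n : nat)
    (M : 'cV[R]_n -> 'M[R]_n) (U : 'cV[R]_n -> R)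
    (xF : 'cV[R]_(n + n) * 'cV[R]_n) : 'cV[R]_(n + n) :=
  let q := usubmx xF.1 in
  let v := dsubmx xF.1 in
  col_mx v (invmx (M q) *m (xF.2 - coriolis M q v *m v - gradient U q)).

Definition position (R : realType) (n : nat) (x : 'cV[R]_(n + n))
    : 'cV[R]_n := usubmx x.

Definition total_energy (R : realType) (n : nat)
    (M : 'cV[R]_n -> 'M[R]_n) (U : 'cV[R]_n -> R) (x : 'cV[R]_(n + n)) : R :=
  let q := usubmx x in
  let v := dsubmx x in
  2^-1 * (v^T *m M q *m v) 0 0 + U q.

Lemma sym_posdef_unitmx (R : realType) (n : nat) (A : 'M[R]_n) :
  sym_posdef A -> A \in unitmx.
Proof.
move=> [_ A_gt0]; rewrite -row_free_unit -kermx_eq0.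
apply/negPn/negP => /rowV0Pn[w /sub_kermxP wA0 w0].
have := A_gt0 w^T; rewrite trmx_eq0 => /(_ w0).
by rewrite trmxK wA0 mul0mx mxE ltxx.
Qed.

Lemma euler_lagrangeP (R : realType) (n : nat) (M : 'cV[R]_n -> 'M[R]_n)
    (U : 'cV[R]_n -> R) (q v a F : 'cV[R]_n) : sym_posdef (M q) ->
  euler_lagrange M U (col_mx q v, F) = col_mx v a <->
  M q *m a + coriolis M q v *m v + gradient U q = F.
Proof.
move=> /sym_posdef_unitmx Mu; rewrite /euler_lagrange /= !col_mxKu !col_mxKd.
split=> [/eq_col_mx[_ <-]|<-].
  by rewrite mulKVmx// [_ - _ + _]addrAC !subrK.
by rewrite addrAC addrK addrK mulKmx.
Qed.

(* Main.v *)
(** Along a solution the energy V = q'^T M q' / 2 + U has derivative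
    q'^T (M q'' + gradient U) + q'^T M' q' / 2, where M' is the time derivative
    of M(q).  The equations of motion turn the first term into
    q'^T F - q'^T C q', and for the Christoffel choice of C the quadratic form
    q'^T C q' equals q'^T M' q' / 2, so V' = q'^T F: the dissipation inequality
    holds with equality.  The vector field is locally Lipschitz because M^-1 is
    the adjugate of M over its determinant, and functions of class C^1 are
    locally Lipschitz by the mean value theorem. *)
Require Import Defs.
From mathcomp Require Import all_boot all_order all_algebra.
From mathcomp Require Import all_classical all_reals all_analysis.
From mathcomp Require Import ring.
Import Order.TTheory GRing.Theory Num.Theory.
Import numFieldNormedType.Exports.
Local Open Scope classical_set_scope.
Local Open Scope ring_scope.

Set Implicit Arguments.
Unset Strict Implicit.
Unset Printing Implicit Defensive.

(** * Closure properties of locally Lipschitz maps, up to the matrix inverse *)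

Section LocallyLipschitz.
Context {R : realType}.
Implicit Types V W Z : normedModType R.

(** One fixed constant and a condition near the diagonal point [(a, a)] can be combined with other
    bounds by filter reasoning. Conversely, a neighbourhood of [(a, a)] contains some [A] times [B],
    and [A] intersected with [B] serves as the Lipschitz neighbourhood of [a]. *)
Lemma locally_lipschitzP V W (f : V -> W) :
  locally_lipschitz f <->
  forall a : V, exists2 k : R, 0 <= k &
    \forall p \near (a, a), `|f p.1 - f p.2| <= k * `|p.1 - p.2|.
Proof.
split=> lf a.
- have [A Aa /pinfty_ex_gt0[k k0 kA]] := lf a.
  exists k; first exact: ltW.
  exists (A, A) => [//|[x y] [/= Ax Ay]]; exact: (kA (x, y)).
- have [k k0 [[A B] [/= Aa Ba] AB]] := lf a.
  exists (A `&` B); first exact: filterI.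
  apply: (@klipschitzW _ _ _ k).
    (* The set of pairs must be inhabited for its filter to be proper; [(a, a)] lies in it. *)
    apply: (@globally_properfilter _ _ (a, a)).
    by split; split; exact: nbhs_singleton.
  by move=> [x y] [[Ax Bx] [Ay By]]; exact: (AB (x, y)).
Qed.

Lemma locally_lipschitz_continuous V W (f : V -> W) :
  locally_lipschitz f -> continuous f.
Proof.
move=> /locally_lipschitzP lf a; have [k k0 [[A B] [/= Aa Ba] AB]] := lf a.
(* The constant [k] may be zero, so [k + 1] is used as the divisor. *)
have k1 : 0 < k + 1 by rewrite ltr_wpDl.
apply/cvgrPdist_lt => e e0; near=> x.
have := AB (a, x); rewrite /= => /(_ _)/le_lt_trans; apply.
  by split; [exact: nbhs_singleton|near: x].
apply: (@le_lt_trans _ _ ((k + 1) * `|a - x|)).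
  by rewrite ler_wpM2r// lerDl.
rewrite -ltr_pdivlMl//; near: x.
by apply: (cvgr_dist_lt id); [exact: cvg_id|rewrite mulr_gt0// invr_gt0].
Unshelve. all: by end_near. Qed.

Lemma lipschitz_locally_lipschitz V W (f : V -> W) (k : R) : 0 <= k ->
  (forall x y, `|f x - f y| <= k * `|x - y|) -> locally_lipschitz f.
Proof.
move=> k0 lf; apply/locally_lipschitzP => a; exists k => //.
by near=> p; exact: lf.
Unshelve. all: by end_near. Qed.

Lemma locally_lipschitz_cst V W (c : W) : locally_lipschitz (fun _ : V => c).
Proof.
apply: (@lipschitz_locally_lipschitz _ _ _ 0) => // x y.
by rewrite subrr normr0 mul0r.
Qed.

Lemma locally_lipschitzD V W (f g : V -> W) :
  locally_lipschitz f -> locally_lipschitz g ->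
  locally_lipschitz (fun x => f x + g x).
Proof.
move=> /locally_lipschitzP lf /locally_lipschitzP lg.
apply/locally_lipschitzP => a.
have [k k0 kf] := lf a; have [l l0 lg'] := lg a.
exists (k + l); first exact: addr_ge0.
near=> p; rewrite opprD addrACA mulrDl (le_trans (ler_normD _ _))//.
by apply: lerD; near: p.
Unshelve. all: by end_near. Qed.

Lemma locally_lipschitzN V W (f : V -> W) :
  locally_lipschitz f -> locally_lipschitz (fun x => - f x).
Proof.
move=> /locally_lipschitzP lf; apply/locally_lipschitzP => a.
have [k k0 kf] := lf a; exists k => //.
by apply: filterS kf => p; rewrite -opprD normrN.
Qed.

Lemma locally_lipschitz_comp V W Z (f : V -> W) (g : W -> Z) :
  locally_lipschitz f -> locally_lipschitz g ->
  locally_lipschitz (fun x => g (f x)).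
Proof.
move=> lf /locally_lipschitzP lg; have cf := locally_lipschitz_continuous lf.
move/locally_lipschitzP in lf.
apply/locally_lipschitzP => a.
have [k k0 kf] := lf a; have [l l0 lg'] := lg (f a).
exists (l * k); first exact: mulr_ge0.
(* By continuity of [f], the estimate for [g] near [(f a, f a)] pulls back to pairs near
   [(a, a)]. *)
have cff : (fun p : V * V => (f p.1, f p.2)) @ (a, a) --> (f a, f a).
  apply: cvg_pair => /=.
    by apply: (cvg_comp _ _ cvg_fst); exact: cf.
  by apply: (cvg_comp _ _ cvg_snd); exact: cf.
have {}lg' := cff _ lg'.
near=> p; apply: (@le_trans _ _ (l * `|f p.1 - f p.2|)).
  by near: p.
by rewrite -mulrA ler_wpM2l//; near: p.
Unshelve. all: by end_near. Qed.

(** Split the difference as f(x)(g(x) - g(y)) + g(y)(f(x) - f(y)); continuity bounds the factors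
    f(x) and g(y) near [a]. *)
Lemma locally_lipschitzM V (f g : V -> R) :
  locally_lipschitz f -> locally_lipschitz g ->
  locally_lipschitz (fun x => f x * g x).
Proof.
move=> lf lg; have cf := locally_lipschitz_continuous lf.
have cg := locally_lipschitz_continuous lg.
move: lf lg => /locally_lipschitzP lf /locally_lipschitzP lg.
apply/locally_lipschitzP => a.
have [k k0 kf] := lf a; have [l l0 lg'] := lg a.
have bnd (h : V -> R) : continuous h -> \forall x \near a, `|h x| <= `|h a| + 1.
  by move=> ch; apply: (cvgr_norm_le _ (ch a)); rewrite ltrDl.
have bf : \forall p \near (a, a), `|f p.1| <= `|f a| + 1.
  exact: (cvg_fst (bnd f cf)).
have bg : \forall p \near (a, a), `|g p.2| <= `|g a| + 1.
  exact: (cvg_snd (bnd g cg)).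
exists ((`|f a| + 1) * l + (`|g a| + 1) * k).
  by rewrite addr_ge0// mulr_ge0// addr_ge0.
near=> p.
have -> : f p.1 * g p.1 - f p.2 * g p.2 =
    f p.1 * (g p.1 - g p.2) + g p.2 * (f p.1 - f p.2).
  by rewrite !mulrBr ![g p.2 * _]mulrC subrKA.
rewrite (le_trans (ler_normD _ _))// mulrDl !normrM -!mulrA.
by apply: lerD; apply: ler_pM => //; near: p.
Unshelve. all: by end_near. Qed.

(** The difference of inverses is (f(y) - f(x)) / (f(x) f(y)), and near [a] continuity keeps |f|
    above |f(a)| / 2, which bounds the denominator away from zero. *)
Lemma locally_lipschitzV V (f : V -> R) : (forall x, f x != 0) ->
  locally_lipschitz f -> locally_lipschitz (fun x => (f x)^-1).
Proof.
move=> f0 lf; have cf := locally_lipschitz_continuous lf.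
move: lf => /locally_lipschitzP lf.
apply/locally_lipschitzP => a.
have [k k0 kf] := lf a.
have fa0 : 0 < `|f a| / 2 by rewrite divr_gt0 ?normr_gt0.
have bf : \forall x \near a, `|f a| / 2 <= `|f x|.
  apply: (cvgr_norm_ge _ (cf a)).
  by rewrite ltr_pdivrMr// ltr_pMr ?normr_gt0// ltr1n.
have bf1 : \forall p \near (a, a), `|f a| / 2 <= `|f p.1|.
  exact: (cvg_fst bf).
have bf2 : \forall p \near (a, a), `|f a| / 2 <= `|f p.2|.
  exact: (cvg_snd bf).
exists (k * ((`|f a| / 2) ^- 2)).
  by rewrite mulr_ge0// invr_ge0 exprn_ge0// ltW.
near=> p.
have -> : (f p.1)^-1 - (f p.2)^-1 = (f p.2 - f p.1) * (f p.1 * f p.2)^-1.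
  by rewrite invfM mulrBl mulrCA mulfV// mulr1 mulrA mulfV// mul1r.
rewrite normrM mulrAC distrC.
apply: ler_pM => //.
  by near: p.
rewrite normfV lef_pV2 ?posrE ?exprn_gt0 ?normr_gt0 ?mulf_neq0//.
by rewrite normrM expr2; apply: ler_pM; rewrite ?(ltW fa0)//; near: p.
Unshelve. all: by end_near. Qed.

Lemma locally_lipschitz_sum V W (I : Type) (r : seq I) (P : pred I)
    (F : I -> V -> W) :
  (forall i, P i -> locally_lipschitz (F i)) ->
  locally_lipschitz (fun x => \sum_(i <- r | P i) F i x).
Proof.
(* Seen as a sum in the ring of functions, the expression is open to [big_ind]. *)
move=> lF; rewrite (_ : (fun x => _) = \sum_(i <- r | P i) F i).
  elim/big_ind : _ => //; first exact: locally_lipschitz_cst.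
  exact: locally_lipschitzD.
by apply/funext => x; rewrite fct_sumE.
Qed.

Lemma locally_lipschitz_prod V (I : Type) (r : seq I) (P : pred I)
    (F : I -> V -> R) :
  (forall i, P i -> locally_lipschitz (F i)) ->
  locally_lipschitz (fun x => \prod_(i <- r | P i) F i x).
Proof.
move=> lF; rewrite (_ : (fun x => _) = \prod_(i <- r | P i) F i).
  elim/big_ind : _ => //; first exact: locally_lipschitz_cst.
  exact: locally_lipschitzM.
by apply/funext => x; rewrite fct_prodE.
Qed.

Lemma locally_lipschitz_fst V W : locally_lipschitz (fst : V * W -> V).
Proof.
apply: (@lipschitz_locally_lipschitz _ _ _ 1) => // x y.
by rewrite mul1r [leRHS]prod_normE le_max lexx.
Qed.

Lemma locally_lipschitz_snd V W : locally_lipschitz (snd : V * W -> W).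
Proof.
apply: (@lipschitz_locally_lipschitz _ _ _ 1) => // x y.
by rewrite mul1r [leRHS]prod_normE le_max lexx orbT.
Qed.

Lemma le_coord_norm m n (A : 'M[R]_(m, n)) i j : `|A i j| <= `|A|.
Proof.
rewrite [leRHS]/Num.Def.normr/= mx_normrE.
exact: (le_bigmax _ (fun ij => `|A ij.1 ij.2|) (i, j)).
Qed.

Lemma locally_lipschitz_coord m n i j :
  locally_lipschitz (fun A : 'M[R]_(m, n) => A i j).
Proof.
apply: (@lipschitz_locally_lipschitz _ _ _ 1) => // A B.
by rewrite mul1r (le_trans _ (le_coord_norm _ i j))// !mxE.
Qed.

(** The matrix norm is the maximum of the entries, so the sum of the entrywise constants dominates
    each of them and serves for the whole matrix. *)
Lemma locally_lipschitz_mxP V m n (f : V -> 'M[R]_(m, n)) :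
  locally_lipschitz f <-> forall i j, locally_lipschitz (fun x => f x i j).
Proof.
split=> [lf i j|lf].
  exact: (locally_lipschitz_comp lf (@locally_lipschitz_coord _ _ i j)).
apply/locally_lipschitzP => a.
have /choice[k kP] : forall ij : 'I_m * 'I_n, exists k : R, 0 <= k /\
    \forall p \near (a, a),
      `|f p.1 ij.1 ij.2 - f p.2 ij.1 ij.2| <= k * `|p.1 - p.2|.
  move=> [i j]; have /locally_lipschitzP/(_ a)[k k0 kf] := lf i j.
  by exists k.
exists (\sum_ij k ij); first by apply: sumr_ge0 => ij _; case: (kP ij).
near=> p.
rewrite [leLHS]/Num.Def.normr/= mx_normrE; apply: bigmax_le.
  by rewrite mulr_ge0// sumr_ge0// => ij _; case: (kP ij).
move=> ij _; rewrite !mxE.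
apply: (@le_trans _ _ (k ij * `|p.1 - p.2|)).
  (* There are finitely many entries, so their estimates hold on a common neighbourhood. *)
  move: ij; near: p; apply: filter_forall => ij; exact: (kP ij).2.
rewrite ler_wpM2r// (bigD1 ij)//= lerDl sumr_ge0// => i _.
by case: (kP i).
Unshelve. all: by end_near. Qed.

Lemma locally_lipschitz_usubmx m1 m2 n :
  locally_lipschitz (usubmx : 'M[R]_(m1 + m2, n) -> 'M[R]_(m1, n)).
Proof.
apply/locally_lipschitz_mxP => i j; under eq_fun do rewrite mxE.
exact: locally_lipschitz_coord.
Qed.

Lemma locally_lipschitz_dsubmx m1 m2 n :
  locally_lipschitz (dsubmx : 'M[R]_(m1 + m2, n) -> 'M[R]_(m2, n)).
Proof.
apply/locally_lipschitz_mxP => i j; under eq_fun do rewrite mxE.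
exact: locally_lipschitz_coord.
Qed.

Lemma locally_lipschitz_col_mx V m1 m2 n (f : V -> 'M[R]_(m1, n))
    (g : V -> 'M[R]_(m2, n)) :
  locally_lipschitz f -> locally_lipschitz g ->
  locally_lipschitz (fun x => col_mx (f x) (g x)).
Proof.
move=> /locally_lipschitz_mxP lf /locally_lipschitz_mxP lg.
apply/locally_lipschitz_mxP => i j; under eq_fun do rewrite mxE.
by case: (fintype.split i) => k; [exact: lf|exact: lg].
Qed.

Lemma locally_lipschitz_mulmx V m n p (f : V -> 'M[R]_(m, n))
    (g : V -> 'M[R]_(n, p)) :
  locally_lipschitz f -> locally_lipschitz g ->
  locally_lipschitz (fun x => f x *m g x).
Proof.
move=> /locally_lipschitz_mxP lf /locally_lipschitz_mxP lg.
apply/locally_lipschitz_mxP => i j; under eq_fun do rewrite mxE.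
by apply: locally_lipschitz_sum => k _; exact: locally_lipschitzM.
Qed.

Lemma locally_lipschitz_det V n (f : V -> 'M[R]_n) :
  locally_lipschitz f -> locally_lipschitz (fun x => \det (f x)).
Proof.
move=> /locally_lipschitz_mxP lf.
apply: locally_lipschitz_sum => s _; apply: locally_lipschitzM.
  exact: locally_lipschitz_cst.
by apply: locally_lipschitz_prod => i _.
Qed.

Lemma locally_lipschitz_invmx V n (f : V -> 'M[R]_n) :
  (forall x, f x \in unitmx) ->
  locally_lipschitz f -> locally_lipschitz (fun x => invmx (f x)).
Proof.
move=> fu lf; apply/locally_lipschitz_mxP => i j.
under eq_fun do rewrite /invmx fu !mxE.
apply: locally_lipschitzM.
  apply: locally_lipschitzV; last exact: locally_lipschitz_det.
  by move=> x; rewrite -unitfE; have := fu x; rewrite unitmxE.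
apply: locally_lipschitzM; first exact: locally_lipschitz_cst.
apply: locally_lipschitz_det; move/locally_lipschitz_mxP in lf.
by apply/locally_lipschitz_mxP => k l; under eq_fun do rewrite !mxE; exact: lf.
Qed.

End LocallyLipschitz.

(** * Functions of class C^1, and their local Lipschitz continuity *)

Section ClassC1.
Context {R : realType}.
Implicit Types U V W : normedModType R.

Lemma class_C1_cst V W (c : W) : class_C1 (fun _ : V => c).
Proof.
split=> [a|v]; first exact: differentiable_cst.
have -> : 'D_v (fun _ : V => c) = cst 0.
  by apply/funext => x; exact: derive_cst.
exact: cst_continuous.
Qed.

Lemma class_C1D V W (f g : V -> W) :
  class_C1 f -> class_C1 g -> class_C1 (fun x => f x + g x).
Proof.
move=> [df cf] [dg cg]; split=> [a|v]; first exact: differentiableD.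
have -> : 'D_v (fun x => f x + g x) = (fun x => 'D_v f x + 'D_v g x).
  by apply/funext => x; rewrite deriveD//; exact: diff_derivable.
by move=> x; apply: cvgD; [exact: cf|exact: cg].
Qed.

Lemma class_C1M V (f g : V -> R) :
  class_C1 f -> class_C1 g -> class_C1 (fun x => f x * g x).
Proof.
move=> [df cf] [dg cg]; split=> [a|v]; first exact: differentiableM.
have -> : 'D_v (fun x => f x * g x) =
    (fun x => f x * 'D_v g x + g x * 'D_v f x).
  by apply/funext => x; rewrite deriveM//; exact: diff_derivable.
move=> x; apply: cvgD; apply: cvgM.
- exact: differentiable_continuous.
- exact: cg.
- exact: differentiable_continuous.
- exact: cf.
Qed.

Lemma class_C1_sum V W (I : Type) (r : seq I) (P : pred I) (F : I -> V -> W) :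
  (forall i, P i -> class_C1 (F i)) ->
  class_C1 (fun x => \sum_(i <- r | P i) F i x).
Proof.
move=> CF; rewrite (_ : (fun x => _) = \sum_(i <- r | P i) F i).
  elim/big_ind : _ => //; first exact: class_C1_cst.
  exact: class_C1D.
by apply/funext => x; rewrite fct_sumE.
Qed.

Lemma derive_comp_linear U V W (L : {linear U -> V}) (f : V -> W) x v :
  continuous L -> differentiable f (L x) ->
  'D_v (f \o L) x = 'D_(L v) f (L x).
Proof.
move=> cL df; have dL := linear_differentiable x cL.
rewrite !deriveE//; last exact: differentiable_comp.
by rewrite diff_comp//= diff_lin.
Qed.

Lemma class_C1_comp_linear U V W (L : {linear U -> V}) (f : V -> W) :
  continuous L -> class_C1 f -> class_C1 (f \o L).
Proof.
move=> cL [df cf]; split=> [a|v].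
  by apply: differentiable_comp => //; exact: linear_differentiable.
have -> : 'D_v (f \o L) = 'D_(L v) f \o L.
  by apply/funext => x; exact: derive_comp_linear.
by move=> x; apply: continuous_comp; [exact: cL|exact: cf].
Qed.

Lemma class_C1_linear V W (L : {linear V -> W}) : continuous L -> class_C1 L.
Proof.
move=> cL; split=> [a|v]; first exact: linear_differentiable.
have -> : 'D_v L = cst (L v).
  apply/funext => x; rewrite deriveE ?diff_lin//.
  exact: linear_differentiable.
exact: cst_continuous.
Qed.

Lemma derive_partial n (f : 'cV[R]_n -> R) (x v : 'cV[R]_n) :
  differentiable f x -> 'D_v f x = \sum_i partial i f x * v i 0.
Proof.
move=> df; rewrite deriveE// {1}(matrix_sum_delta v) linear_sum.
apply: eq_bigr => i _; rewrite big_ord1 linearZ /= mulrC.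
by rewrite /partial deriveE.
Qed.

(** The one-variable mean value theorem applied to t |-> f(x + t(y - x)) on [0, 1]. *)
Lemma mean_value_segment V (f : V -> R) (x y : V) :
  (forall z, differentiable f z) ->
  exists2 t : R, t \in `[0, 1] & f y - f x = 'D_(y - x) f (x + t *: (y - x)).
Proof.
move=> df; set w := y - x.
pose l (t : R) := x + t *: w.
have dl (t : R) : is_diff t l ( *:%R ^~ w).
  have -> : l = cst x + ( *:%R ^~ w) by [].
  by apply: is_diff_eq; rewrite add0r.
have dfl (t : R) : is_derive t (1 : R) (f \o l) ('D_w f (l t)).
  have d : differentiable (f \o l) t by exact: differentiable_comp.
  apply: DeriveDef; first exact: diff_derivable.
  by rewrite !deriveE// diff_comp//= [in X in 'd f _ X]diff_val scale1r.
have [|t t01] := @MVT_segment _ (f \o l) (fun t => 'D_w f (l t)) 0 1 ler01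
    (fun t _ => dfl t).
  apply: continuous_subspaceT => t.
  by apply: differentiable_continuous; exact: differentiable_comp.
rewrite /l /= scale1r scale0r addr0 /w [x + _]addrC subrK subr0 mulr1 => ft.
by exists t.
Qed.

(** On a small ball around [a] each partial derivative stays below its absolute value at [a] plus
    one. Since |v_i| <= |v|, the sum of these bounds controls the directional derivative that the
    mean value theorem yields. *)
Lemma class_C1_locally_lipschitz n (f : 'cV[R]_n -> R) :
  class_C1 f -> locally_lipschitz f.
Proof.
move=> [df cf]; apply/locally_lipschitzP => a.
exists (\sum_i (`|partial i f a| + 1)).
  by apply: sumr_ge0 => i _; rewrite addr_ge0.
have : \forall x \near a, forall i, `|partial i f x| <= `|partial i f a| + 1.
  apply: (filter_forall (nbhs_filter a)) => i.
  by apply: (cvgr_norm_le _ (cf (delta_mx i 0) a)); rewrite ltrDl.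
rewrite -nbhs_nearE => /nbhs_ballP[r /= r0 Br].
exists (ball a r, ball a r); first by split; exact: nbhsx_ballx.
move=> [x y] [/= ax ay].
have [t t01 ->] := mean_value_segment y x df.
rewrite derive_partial//.
(* Balls are convex: a minus the intermediate point is the convex combination t(a - x) + (1 - t)(a -
   y). *)
have Bt : ball a r (y + t *: (x - y)).
  move: ax ay t01; rewrite -!ball_normE /= in_itv /= => ax ay /andP[t0 t1].
  have -> : a - (y + t *: (x - y)) = t *: (a - x) + (1 - t) *: (a - y).
    rewrite scalerBl scale1r [RHS]addrCA -scalerBr opprB.
    rewrite [a - x + _]addrC subrKA.
    by rewrite opprD addrA -scalerN opprB.
  have -> : r = t * r + (1 - t) * r by rewrite -mulrDl addrC subrK mul1r.
  rewrite (le_lt_trans (ler_normD _ _))// !normrZ ger0_norm//.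
  rewrite ger0_norm ?subr_ge0//.
  (* Strictness comes from t|a - x| < t r, which fails at t = 0; there the intermediate point is [y]
     itself. *)
  have [->|tn0] := eqVneq t 0.
    by rewrite !mul0r !add0r subr0 !mul1r.
  apply: ltr_leD; first by rewrite ltr_pM2l// lt_def tn0.
  by rewrite ler_wpM2l ?subr_ge0// ltW.
rewrite (le_trans (ler_norm_sum _ _ _))// mulr_suml; apply: ler_sum => i _.
rewrite normrM; apply: ler_pM => //; first exact: Br.
exact: le_coord_norm.
Qed.

End ClassC1.

(** * Chain rule along curves on the half-line *)

Section TimeDerivative.
Context {R : realType}.
Implicit Types U V W : normedModType R.

(** With d = x(t + h) - x(t), the increment of [f] is its differential at d plus a remainder e(d) =
    o(d). Since d / h converges it is bounded, so e(d) / h tends to 0. Only filter properties of the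
    restricted limit enter, so the one-sided case t = 0 is covered as well. *)
Lemma has_time_derivative_comp V W (f : V -> W) (x : R -> V) (t : R) (l : V) :
  has_time_derivative x t l -> differentiable f (x t) ->
  has_time_derivative (f \o x) t ('d f (x t) l).
Proof.
rewrite /has_time_derivative; set F := within _ _ => xl df.
have FF : Filter F by exact: within_filter.
have F0 : F [set h | h != 0].
  by rewrite /F /within /=; near=> h => _ /=; near: h; exact: nbhs_dnbhs_neq.
have h0 : id @ F --> (0 : R).
  by apply: cvg_trans (cvg_within _) _; exact: cvg_within.
(* The increment is h times the difference quotient, hence tends to 0 times [l]. *)
have dx0 : (fun h => x (t + h) - x t) @ F --> (0 : V).
  rewrite -[0 in X in _ --> X](scale0r l).
  apply: cvg_trans (cvgZ h0 xl).
  apply: near_eq_cvg; near=> h.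
  by rewrite scalerA mulfV ?scale1r//; near: h.
pose e (y : V) := f (x t + y) - f (x t) - 'd f (x t) y.
have er : (fun h => h^-1 *: e (x (t + h) - x t)) @ F --> (0 : W).
  apply/cvgr0Pnorm_le => eps eps0.
  have l1 : 0 < `|l| + 1 by rewrite ltr_wpDl.
  (* The quotient d / h is eventually bounded by [|l| + 1], so this tolerance leaves exactly
     [eps]. *)
  have /eqaddoP/(_ (eps / (`|l| + 1))) := diff_locally df.
  rewrite divr_gt0// => /(_ isT) /dx0 oe.
  have xb : \forall h \near F, `|h^-1 *: (x (t + h) - x t)| <= `|l| + 1.
    by apply: (cvgr_norm_le _ xl); rewrite ltrDl.
  near=> h.
  have hn0 : h != 0 by near: h.
  have oeh : `|e (x (t + h) - x t)| <= eps / (`|l| + 1) * `|x (t + h) - x t|.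
    have -> : e (x (t + h) - x t) =
        (f \o shift (x t) - (cst (f (x t)) + 'd f (x t))) (x (t + h) - x t).
      by rewrite /e [x t + _]addrC /= !fctE opprD addrA.
    by near: h.
  rewrite normrZ (le_trans (ler_wpM2l _ oeh))//.
  rewrite mulrCA -normrZ mulrAC ler_pdivrMr// ler_pM2l//.
  by near: h.
have -> : 'd f (x t) l = 'd f (x t) l + 0 by rewrite addr0.
have cL : (fun h => 'd f (x t) (h^-1 *: (x (t + h) - x t))) @ F -->
    'd f (x t) l.
  by apply: (cvg_comp _ _ xl); exact: diff_continuous.
apply: cvg_trans (cvgD cL er).
apply: near_eq_cvg; near=> h; rewrite fctE.
by rewrite linearZ/= -scalerDr /e addrC subrK [x t + _]addrC subrK.
Unshelve. all: by end_near. Qed.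

End TimeDerivative.

(** * Energy balance and regularity of the Euler-Lagrange system *)

Section EulerLagrange.
Context {R : realType}.

Lemma derive_coord m n (i : 'I_m) (j : 'I_n) (A B : 'M[R]_(m, n)) :
  'D_B (fun C : 'M[R]_(m, n) => C i j) A = B i j.
Proof.
have := derive_mx (@derivable_id _ _ A B).
by rewrite derive_id => /matrixP/(_ i j); rewrite mxE.
Qed.

Lemma class_C1_coord m n (i : 'I_m) (j : 'I_n) :
  class_C1 (fun C : 'M[R]_(m, n) => C i j).
Proof.
split=> [A|B]; first exact: differentiable_coord.
rewrite (_ : 'D_B _ = cst (B i j)); first exact: cst_continuous.
by apply/funext => A; exact: derive_coord.
Qed.

Lemma quad_formE n (A : 'M[R]_n) (v w : 'cV[R]_n) :
  (v^T *m A *m w) 0 0 = \sum_j \sum_k v k 0 * A k j * w j 0.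
Proof.
rewrite mxE; apply: eq_bigr => j _; rewrite mxE mulr_suml.
by apply: eq_bigr => k _; rewrite mxE.
Qed.

(** A 1 by 1 matrix equals its transpose. *)
Lemma sym_quad_formC n (A : 'M[R]_n) (v w : 'cV[R]_n) : A^T = A ->
  (v^T *m A *m w) 0 0 = (w^T *m A *m v) 0 0.
Proof.
move=> As; transitivity ((v^T *m A *m w)^T 0 0); first by rewrite [RHS]mxE.
by rewrite !trmx_mul trmxK As mulmxA.
Qed.

Variable n : nat.
Variables (M : 'cV[R]_n -> 'M[R]_n) (U : 'cV[R]_n -> R).

Let Mdot (q v : 'cV[R]_n) : 'M[R]_n :=
  \matrix_(k, j) 'D_v (fun p => M p k j) q.

(* Skew-symmetry of [Mdot q v - 2 C(q, v)], tested on the velocity [v] only. *)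
Lemma coriolis_quad_form (q v : 'cV[R]_n) :
  (forall k j, differentiable (fun p => M p k j) q) ->
  (forall p, (M p)^T = M p) ->
  (v^T *m coriolis M q v *m v) 0 0 = 2^-1 * (v^T *m Mdot q v *m v) 0 0.
Proof.
move=> dM Ms; rewrite !quad_formE mulr_sumr.
have MC k j : (fun p => M p k j) = (fun p => M p j k).
  by apply/funext => p; rewrite -[in LHS]Ms mxE.
(* After contraction with the velocities, the three Christoffel terms are this single expression
   with permuted indices; symmetry of [M] brings the third into that shape. *)
pose T i j k := v k 0 * partial i (fun p => M p k j) q * v i 0 * v j 0.
transitivity (\sum_j \sum_k \sum_i 2^-1 * (T i j k + T j i k - T k i j)).
  apply: eq_bigr => j _; apply: eq_bigr => k _.
  rewrite mxE mulrCA -!mulrA -mulr_sumr; congr (_ * _).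
  rewrite mulrCA mulr_suml; apply: eq_bigr => i _.
  rewrite /T (MC i j); ring.
have -> : \sum_j \sum_k \sum_i 2^-1 * (T i j k + T j i k - T k i j) =
    \sum_j \sum_k \sum_i 2^-1 * T i j k +
    (\sum_j \sum_k \sum_i 2^-1 * T j i k - \sum_j \sum_k \sum_i 2^-1 * T k i j).
  rewrite -sumrB -big_split; apply: eq_bigr => j _ /=.
  rewrite -sumrB -big_split; apply: eq_bigr => k _ /=.
  rewrite -sumrB -big_split; apply: eq_bigr => i _ /=.
  by rewrite -mulrBr -mulrDr addrA.
(* The last two Christoffel terms cancel once [j] and [k] are exchanged. *)
rewrite [X in _ + (X - _)]exchange_big subrr addr0.
apply: eq_bigr => j _; rewrite mulr_sumr; apply: eq_bigr => k _.
rewrite mxE derive_partial// mulr_sumr mulr_suml mulr_sumr.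
by apply: eq_bigr => i _; rewrite /T !mulrA.
Qed.

Hypothesis M_C1 : forall k j, class_C1 (fun q => M q k j).
Hypothesis U_C1 : class_C1 U.

Let usubmx_continuous :=
  locally_lipschitz_continuous (@locally_lipschitz_usubmx R n n 1).

(** Writes the energy with sums and products of coordinates and of functions composed with the
    linear map [usubmx], the form to which the C^1 and derivative rules apply. *)
Lemma total_energyE : total_energy M U =
  (fun x => 2^-1 * (\sum_j \sum_k x (rshift n k) 0 * M (usubmx x) k j *
    x (rshift n j) 0) + U (usubmx x)).
Proof.
apply/funext => x; rewrite /total_energy quad_formE.
congr (_ * _ + _); apply: eq_bigr => j _; apply: eq_bigr => k _.
by rewrite !mxE.
Qed.

Lemma class_C1_total_energy : class_C1 (total_energy M U).
Proof.
rewrite total_energyE; apply: class_C1D; last first.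
  exact: (@class_C1_comp_linear _ _ _ _ usubmx U).
apply: class_C1M; first exact: class_C1_cst.
apply: class_C1_sum => j _; apply: class_C1_sum => k _.
apply: class_C1M; last exact: class_C1_coord.
apply: class_C1M; first exact: class_C1_coord.
exact: (@class_C1_comp_linear _ _ _ _ usubmx (fun q => M q k j)).
Qed.

(** Product rule on the kinetic energy: differentiating the two velocity factors gives v^T M a and
    a^T M v, which agree by symmetry and absorb the factor 1/2; differentiating [M] gives the [Mdot]
    term. *)
Lemma derive_total_energy (q v a : 'cV[R]_n) : (M q)^T = M q ->
  'D_(col_mx v a) (total_energy M U) (col_mx q v) =
  (v^T *m M q *m a) 0 0 + 2^-1 * (v^T *m Mdot q v *m v) 0 0 + 'D_v U q.
Proof.
move=> Ms.
set x := col_mx q v; set w := col_mx v a.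
pose c k (x : 'cV[R]_(n + n)) := x (rshift n k) 0.
have dc k : is_derive x w (c k) (a k 0).
  apply: DeriveDef; first exact/diff_derivable/differentiable_coord.
  by rewrite derive_coord col_mxEd.
have dcomp (f : 'cV[R]_n -> R) : class_C1 f ->
    is_derive x w (f \o usubmx) ('D_v f q).
  move=> [df _]; apply: DeriveDef.
    apply: diff_derivable; apply: differentiable_comp => //.
    exact: linear_differentiable.
  by rewrite derive_comp_linear//= /x /w !col_mxKu.
have dM k j := dcomp _ (M_C1 k j).
have dU := dcomp _ U_C1.
(* As an algebraic combination of functions, the energy can be differentiated by [derive_val] from
   the [is_derive] facts above. *)
have -> : total_energy M U =
    2^-1 *: (\sum_j \sum_k (c k * ((fun q => M q k j) \o usubmx) * c j)) +
    (U \o usubmx).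
  rewrite total_energyE; apply/funext => y.
  rewrite !fctE; congr (_ + _); congr (_ * _).
  rewrite fct_sumE; apply: eq_bigr => j _.
  by rewrite fct_sumE; apply: eq_bigr => k _.
rewrite derive_val; congr (_ + _).
rewrite (_ : (v^T *m M q *m a) 0 0 =
    2^-1 * ((v^T *m M q *m a) 0 0 + (a^T *m M q *m v) 0 0)); last first.
  by rewrite (sym_quad_formC _ _ Ms); field.
rewrite -mulrDr !quad_formE -!big_split; congr (_ * _).
apply: eq_bigr => j _ /=; rewrite -!big_split; apply: eq_bigr => k _ /=.
rewrite !mxE /c !fctE /= /x !col_mxEd col_mxKu /GRing.scale /=.
ring.
Qed.

Lemma has_time_derivative_usubmx (x : R -> 'cV[R]_(n + n)) (t : R)
    (l : 'cV[R]_(n + n)) : has_time_derivative x t l ->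
  has_time_derivative (@position R n \o x) t (usubmx l).
Proof.
move=> xl; rewrite -(diff_lin (x t) (f := usubmx) usubmx_continuous).
apply: has_time_derivative_comp => //.
exact: (@linear_differentiable _ _ _ usubmx).
Qed.

Hypothesis M_posdef : forall q, sym_posdef (M q).

(** Power balance: the energy changes at the rate at which the forces do work. It holds at every
    state and force, so along a solution only the chain rule remains. *)
Lemma derive_total_energy_euler_lagrange (x : 'cV[R]_(n + n)) (F : 'cV[R]_n) :
  'D_(euler_lagrange M U (x, F)) (total_energy M U) x =
  ((dsubmx x)^T *m F) 0 0.
Proof.
rewrite -[in X in derive _ X _](vsubmxK x) /euler_lagrange /=.
set q := usubmx x; set v := dsubmx x.
rewrite derive_total_energy; last by case: (M_posdef q).
(* The [Mdot] term becomes the Coriolis form, which cancels the Coriolis force in the acceleration;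
   the gradient of [U] cancels likewise. *)
rewrite -coriolis_quad_form; last 2 first.
- by move=> k j; case: (M_C1 k j).
- by move=> p; case: (M_posdef p).
rewrite -mulmxA mulKVmx; last exact: sym_posdef_unitmx.
have -> : 'D_v U q = (v^T *m gradient U q) 0 0.
  rewrite derive_partial; last by case: U_C1.
  by rewrite mxE; apply: eq_bigr => i _; rewrite !mxE mulrC.
by rewrite !mulmxBr !mulmxA !mxE addrAC !subrK.
Qed.

Hypothesis U0 : U 0 = 0.
Hypothesis U_min : strict_absolute_minimum_at U 0.

(** A nonzero velocity makes the kinetic energy positive while U >= 0. If the velocity vanishes, a
    nonzero state has nonzero position, and the strict minimum gives U > 0. *)
Lemma total_energy_posdef : posdef_function (total_energy M U).
Proof.
split=> [|x x0].
  by rewrite /total_energy !linear0 mxE mulr0 add0r.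
rewrite /total_energy; set q := usubmx x; set v := dsubmx x.
have Uge0 : 0 <= U q.
  by have [->|/U_min] := eqVneq q 0; rewrite U0// => /ltW.
have [v0|v0] := eqVneq v 0.
  rewrite v0 mulmx0 mxE mulr0 add0r -U0; apply: U_min.
  by apply: contraNneq x0 => q0; rewrite -(vsubmxK x) -/q -/v q0 v0 col_mx0.
by rewrite ltr_wpDr// mulr_gt0// ?invr_gt0//; apply: (M_posdef q).2.
Qed.

Lemma total_energy_storage_function :
  is_storage_function (euler_lagrange M U) (@position R n) (total_energy M U).
Proof.
have [V0 Vgt0] := total_energy_posdef.
have V_C1 := class_C1_total_energy.
split=> [x||T u x xsol t t0 tT] //.
  by have [->|/Vgt0/ltW//] := eqVneq x 0; rewrite V0.
have xl := xsol t t0 tT; set l := euler_lagrange _ _ _ in xl.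
(* The output rate is the upper half of the vector field, the velocity, so the power balance gives
   the inequality as an equality. *)
exists ('D_l (total_energy M U) (x t)), (usubmx l); split.
- rewrite deriveE; last exact: V_C1.1.
  by apply: has_time_derivative_comp => //; exact: V_C1.1.
- exact: has_time_derivative_usubmx.
- by rewrite derive_total_energy_euler_lagrange /l /euler_lagrange /= col_mxKu.
Qed.

Hypothesis M_C11 : forall k j, class_C11 (fun q => M q k j).
Hypothesis U_C11 : class_C11 U.

(** The vector field contains first partial derivatives of [M] and [U], locally Lipschitz by the
    C^{1,1} hypotheses; it is built from them, the state and the force by sums, products and the
    inverse of [M]. *)
Lemma euler_lagrange_locally_lipschitz :
  locally_lipschitz (euler_lagrange M U).
Proof.
pose X := ('cV[R]_(n + n) * 'cV[R]_n)%type.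
have lx : locally_lipschitz (fun xF : X => xF.1).
  exact: locally_lipschitz_fst.
have lq : locally_lipschitz (fun xF : X => usubmx xF.1).
  exact: locally_lipschitz_comp lx (@locally_lipschitz_usubmx _ _ _ _).
have lv : locally_lipschitz (fun xF : X => dsubmx xF.1).
  exact: locally_lipschitz_comp lx (@locally_lipschitz_dsubmx _ _ _ _).
have lpartial i f : class_C11 f ->
    locally_lipschitz (fun xF : X => partial i f (usubmx xF.1)).
  by move=> [_ lf]; exact: locally_lipschitz_comp lq (lf _).
apply: locally_lipschitz_col_mx => //.
apply: locally_lipschitz_mulmx.
  apply: locally_lipschitz_invmx; first by move=> xF; exact: sym_posdef_unitmx.
  apply: (locally_lipschitz_comp lq).
  by apply/locally_lipschitz_mxP => i j; exact: class_C1_locally_lipschitz.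
apply: locally_lipschitzD.
  apply: locally_lipschitzD; first exact: locally_lipschitz_snd.
  apply: locally_lipschitzN; apply: locally_lipschitz_mulmx => //.
  apply/locally_lipschitz_mxP => k j; under eq_fun do rewrite mxE.
  apply: locally_lipschitzM; first exact: locally_lipschitz_cst.
  apply: locally_lipschitz_sum => i _; apply: locally_lipschitzM; last first.
    by move/locally_lipschitz_mxP : lv; exact.
  apply: locally_lipschitzD; last exact/locally_lipschitzN/lpartial.
  by apply: locally_lipschitzD; exact: lpartial.
apply: locally_lipschitzN; apply/locally_lipschitz_mxP => k j.
by under eq_fun do rewrite mxE; exact: lpartial.
Qed.

End EulerLagrange.

Theorem lemma2 (R : realType) (M : 'cV[R]_6 -> 'M[R]_6) (U : 'cV[R]_6 -> R)
  (M_smooth : forall k j, class_C11 (fun q => M q k j))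
  (U_smooth : class_C11 U)
  (M_posdef : forall q, sym_posdef (M q))
  (U_normalized : U 0 = 0)
  (U_min : strict_absolute_minimum_at U 0) :
  [/\ nonlinear_negative_imaginary (euler_lagrange M U) (@position R 6),
      is_storage_function (euler_lagrange M U) (@position R 6)
        (total_energy M U) &
      posdef_function (total_energy M U)].
Proof.
have M_C1 k j := (M_smooth k j).1; have U_C1 := U_smooth.1.
have energy_storage : is_storage_function (euler_lagrange M U)
    (@position R 6) (total_energy M U) by exact: total_energy_storage_function.
split=> //; last exact: total_energy_posdef.
split; last by exists (total_energy M U).
  exact: euler_lagrange_locally_lipschitz.
apply: (@class_C1_linear _ _ _ usubmx).
exact/locally_lipschitz_continuous/locally_lipschitz_usubmx.
Qed.
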